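(* Let $F$ be a field and let $A$ be an $F$-algebra (not necessarily associative, commutative or unital) which is generated as an algebra by two primitive axes $a$ and $b$, where $a$ is of type $(\lambda,\delta)$ and $b$ is of type $(\lambda',\delta')$, with $\lambda,\delta,\lambda',\delta'\in F\setminus\{0,1\}$. If $\dim_F(A)=3$, then $a$ and $b$ are of Jordan type; that is, $A_{\lambda,0}(a)=0=A_{0,\delta}(a)$ and $A_{\lambda',0}(b)=0=A_{0,\delta'}(b)$.
   Context: For $a\in A$ let $L_a(x)=ax$ and $R_a(x)=xa$ $(x\in A)$. For $\mu,\nu\in F$ put $A_\mu(L_a)=\{v\in A: av=\mu v\}$, $A_\mu(R_a)=\{v\in A: va=\mu v\}$ and $A_{\mu,\nu}(a)=A_\mu(L_a)\cap A_\nu(R_a)$; these may be $0$. Let $\lambda,\delta\in F\setminus\{0,1\}$. An idempotent $a\in A$ ($a^2=a$) is a primitive axis of type $(\lambda,\delta)$ if all of the following hold: (1) $(L_a-\lambda)(L_a-1)L_a=0$, $A_1(L_a)=Fa$, and the decomposition $A=A^+\oplus A^-$ with $A^+=Fa\oplus A_0(L_a)$, $A^-=A_\lambda(L_a)$ is a $\mathbb{Z}_2$-grading (i.e. $A^+A^+\subseteq A^+$, $A^+A^-\subseteq A^-$, $A^-A^+\subseteq A^-$, $A^-A^-\subseteq A^+$); (2) $(R_a-\delta)(R_a-1)R_a=0$, $A_1(R_a)=Fa$, and the decomposition $A=(Fa\oplus A_0(R_a))\oplus A_\delta(R_a)$ is likewise a $\mathbb{Z}_2$-grading with even part $Fa\oplus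 A_0(R_a)$ and odd part $A_\delta(R_a)$; (3) $L_aR_a=R_aL_a$. A primitive axis $a$ of type $(\lambda,\delta)$ is of Jordan type if $A_{\lambda,0}(a)=0=A_{0,\delta}(a)$. *)

(* Defs.v *)
From mathcomp Require Import all_boot all_order all_algebra.

Set Implicit Arguments.
Unset Strict Implicit.
Unset Printing Implicit Defensive.

Import GRing.Theory.
Local Open Scope ring_scope.

(* A nonassociative F-algebra is a vector space A with an arbitrary bilinear  *)
(* product mul; the ring structures of the library are associative and unital *)
(* and so cannot be used for A.                                               *)

Section Axes.

Variables (F : fieldType) (A : vectType F) (mul : {bilinear A -> A -> A}).
Implicit Types (a b : A) (mu nu lam del : F) (f : 'End(A)).
Implicit Types U V W : {vspace A}.

Definition Lmul a : 'End(A) := linfun (mul a).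
Definition Rmul a : 'End(A) := linfun (applyr mul a).

(* For x in A: (x \in Aeig a mu nu) iff a x = mu x and x a = nu x. *)
Definition Aeig a mu nu : {vspace A} :=
  (passmx.leigenspace (Lmul a) mu :&: passmx.leigenspace (Rmul a) nu)%VS.

Definition prod_in U V W : Prop := {in U & V, forall u v, mul u v \in W}.

Definition generated_by a b : Prop :=
  forall U, a \in U -> b \in U -> prod_in U U U -> U = fullv.

Definition Z2_grading U V : Prop :=
  (U + V)%VS = fullv /\ directv (U + V) /\
  [/\ prod_in U U U, prod_in U V V, prod_in V U V & prod_in V V U].

(* The common shape of the conditions on L_a (eigenvalue lambda) and on R_a   *)
(* (eigenvalue delta): f is one of these two operators, mu its eigenvalue.    *)
Definition one_sided_axis a f mu : Prop :=
  [/\ ((f - mu *: \1) \o (f - \1) \o f)%VF = 0,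
      passmx.leigenspace f 1 = <[a]>%VS,
      directv (<[a]> + passmx.leigenspace f 0)
    & Z2_grading (<[a]> + passmx.leigenspace f 0)%VS (passmx.leigenspace f mu)].

Definition primitive_axis a lam del : Prop :=
  [/\ mul a a = a,
      one_sided_axis a (Lmul a) lam,
      one_sided_axis a (Rmul a) del
    & (Lmul a \o Rmul a)%VF = (Rmul a \o Lmul a)%VF].

Definition Jordan_type a lam del : Prop :=
  [/\ primitive_axis a lam del, Aeig a lam 0 = 0%VS & Aeig a 0 del = 0%VS].

End Axes.

(* Main.v *)
(* Passing to the opposite algebra and exchanging a and b, it suffices to show
   A_{lam,0}(a) = 0. The gradings of a decompose A into F a and the joint
   eigenspaces A_{mu,nu}(a) with mu in {0, lam} and nu in {0, del}. If w is such
   a joint eigenvector, then b = al a + w is impossible: b^2 = b puts w^2 into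
   the span of a and w, which is then a proper subalgebra containing a and b.
   Hence, if A_{lam,0}(a) is nonzero, b = al a + x + w with x in A_{lam,0}(a)
   and w in one of the other three eigenspaces, and a, x, w form a basis.
   - w in A_{lam,del}: the grading forces xw = wx = 0 and x^2, w^2 in F a, and
     b^2 = b gives al lam = 1 = al (lam + del).
   - w in A_{0,del}: likewise al lam = 1 = al del; now L_b R_b = R_b L_b yields
     x^2 = w^2 = 0, so al = 1 = lam.
   - w in A_{0,0}: ba = al a, so al is an eigenvalue of L_b and thus al = 0;
     L_b R_b = R_b L_b and b^2 = b then give xb = x, contradicting
     A_1(R_b) = F b. *)

Require Import Defs.
From HB Require Import structures.
From mathcomp Require Import all_boot all_order all_algebra.
From mathcomp Require Import ring.

Set Implicit Arguments.
Unset Strict Implicit.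
Unset Printing Implicit Defensive.

Import GRing.Theory.
Local Open Scope ring_scope.

(** * Linear algebra of eigenspaces and of three independent vectors *)

Section Eigenvectors.

Variables (F : fieldType) (A : vectType F).
Implicit Types (f : 'End(A)) (u v w : A).

Lemma mem_leigenspace f mu v :
  (v \in passmx.leigenspace f mu) = (f v == mu *: v).
Proof.
by rewrite memv_ker add_lfunE opp_lfunE scale_lfunE id_lfunE subr_eq0.
Qed.

Lemma free3_coords u v w (c1 c2 c3 : F) :
    u != 0 -> v \notin <[u]>%VS -> w \notin (<[u]> + <[v]>)%VS ->
  c1 *: u + c2 *: v + c3 *: w = 0 -> [/\ c1 = 0, c2 = 0 & c3 = 0].
Proof.
move=> u0 uv uvw e.
have c30: c3 = 0.
  apply/eqP; apply: contraNT uvw => c30.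
  rewrite -[w]scale1r -(mulVf c30) -scalerA rpredZ //.
  rewrite -[c3 *: w](addKr (c1 *: u + c2 *: v)) e addr0 rpredN.
  by rewrite memv_add ?rpredZ ?memv_line.
have c20: c2 = 0.
  apply/eqP; apply: contraNT uv => c20.
  rewrite -[v]scale1r -(mulVf c20) -scalerA rpredZ //.
  move: e; rewrite c30 scale0r addr0 => e.
  by rewrite -[c2 *: v](addKr (c1 *: u)) e addr0 rpredN rpredZ ?memv_line.
split=> //; move/eqP: e.
by rewrite c20 c30 !scale0r !addr0 scaler_eq0 (negPf u0) orbF => /eqP.
Qed.

Lemma span3_full u v w :
    \dim {:A} = 3%N ->
    u != 0 -> v \notin <[u]>%VS -> w \notin (<[u]> + <[v]>)%VS ->
  (<[u]> + <[v]> + <[w]>)%VS = fullv.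
Proof.
move=> dA u0 uv uvw; apply/eqP; rewrite eqEdim subvf /= dA.
have fr : free [:: w; v; u].
  rewrite !free_cons nil_free !span_cons span_nil addv0 uv.
  by rewrite (addvC <[v]>%VS) uvw memv0 u0.
move: fr; rewrite /free => /eqP /= fr.
by rewrite -{1}fr !span_cons span_nil addv0 (addvC <[v]>%VS) addvC.
Qed.

End Eigenvectors.

(** * Eigenvalues, decomposition and grading for one of the operators of an axis *)

Section OneSidedAxis.

Variables (F : fieldType) (A : vectType F) (mul : {bilinear A -> A -> A}).
Variables (a : A) (f : 'End(A)) (mu : F).
Hypotheses (fa : f a = a) (hf : one_sided_axis mul a f mu).
Implicit Types u v : A.

Lemma axis_eigenvalue c v :
  v != 0 -> f v = c *: v -> [\/ c = 0, c = 1 | c = mu].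
Proof.
move=> v0 fv; case: hf => /lfunP /(_ v) + _ _ _.
rewrite !(comp_lfunE, add_lfunE, opp_lfunE, scale_lfunE, id_lfunE, zero_lfunE).
have fZ k : f (k *: v) = (k * c) *: v by rewrite linearZ /= fv scalerA.
rewrite fv fZ -scalerBl fZ scalerA -scalerBl.
have -> : (c * c - c) * c - mu * (c * c - c) = c * (c - 1) * (c - mu) by ring.
move/eqP; rewrite scaler_eq0 (negPf v0) orbF !mulf_eq0 !subr_eq0 -orbA.
by case/or3P => /eqP ->; [constructor 1|constructor 2|constructor 3].
Qed.

Lemma axis_fixed v : f v = v -> v \in <[a]>%VS.
Proof. by case: hf => _ <- _ _ fv; rewrite mem_leigenspace fv scale1r. Qed.

Lemma axis_decomp v :
  exists p q r, [/\ v = p + q + r, p \in <[a]>%VS, f q = 0 & f r = mu *: r].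
Proof.
case: hf => _ _ _ [e _]; have := memvf v.
rewrite -e => /memv_addP [s /memv_addP [p pa [q q0 ->]] [r rr ->]].
exists p, q, r; split=> //; last by apply/eqP; rewrite -mem_leigenspace.
by apply/eqP; rewrite -[0](scale0r q) -mem_leigenspace.
Qed.

Let even := (<[a]> + passmx.leigenspace f 0)%VS.
Let odd := passmx.leigenspace f mu.

(** [f] is the identity on the line of [a] and zero on its kernel, hence idempotent on the even
    part. Evenness is used later only through this equation, which can be read off coordinate by
    coordinate. *)
Lemma axis_even v : v \in even -> f (f v) = f v.
Proof.
move=> /memv_addP [p /vlineP [c ->] [q]].
rewrite mem_leigenspace scale0r => /eqP q0 ->.
have e : f (c *: a + q) = c *: a by rewrite linearD linearZ /= fa q0 addr0.
by rewrite e linearZ /= fa.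
Qed.

Lemma mem_even v : f v = 0 -> v \in even.
Proof.
move=> v0; rewrite -[v]add0r memv_add ?mem0v //.
by rewrite mem_leigenspace v0 scale0r.
Qed.

Lemma mem_odd v : f v = mu *: v -> v \in odd.
Proof. by move=> e; rewrite mem_leigenspace e. Qed.

Lemma axis_mul00 u v : f u = 0 -> f v = 0 -> f (f (mul u v)) = f (mul u v).
Proof.
case: hf => _ _ _ [_ [_ [h _ _ _]]] u0 v0.
by apply: axis_even; apply: h; apply: mem_even.
Qed.

Lemma axis_mul11 u v :
  f u = mu *: u -> f v = mu *: v -> f (f (mul u v)) = f (mul u v).
Proof.
case: hf => _ _ _ [_ [_ [_ _ _ h]]] u0 v0.
by apply: axis_even; apply: h; apply: mem_odd.
Qed.

Lemma axis_mul01 u v :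
  f u = 0 -> f v = mu *: v -> f (mul u v) = mu *: mul u v.
Proof.
case: hf => _ _ _ [_ [_ [_ h _ _]]] u0 v0.
by apply/eqP; rewrite -mem_leigenspace; apply: h;
  [apply: mem_even|apply: mem_odd].
Qed.

Lemma axis_mul10 u v :
  f u = mu *: u -> f v = 0 -> f (mul u v) = mu *: mul u v.
Proof.
case: hf => _ _ _ [_ [_ [_ _ h _]]] u0 v0.
by apply/eqP; rewrite -mem_leigenspace; apply: h;
  [apply: mem_odd|apply: mem_even].
Qed.

End OneSidedAxis.

(** * Joint eigenspaces of the commuting operators of an axis *)

Section PrimitiveAxis.

Variables (F : fieldType) (A : vectType F) (mul : {bilinear A -> A -> A}).
Variables (a : A) (lam del : F).
Hypotheses (hlam0 : lam != 0) (hdel0 : del != 0) (hdel1 : del != 1).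
Hypothesis ha : primitive_axis mul a lam del.

Lemma LmulE c v : Lmul mul c v = mul c v.
Proof. by rewrite lfunE. Qed.

Lemma RmulE c v : Rmul mul c v = mul v c.
Proof. by rewrite lfunE. Qed.

Lemma mem_Aeig mu nu v :
  reflect (mul a v = mu *: v /\ mul v a = nu *: v) (v \in Aeig mul a mu nu).
Proof.
rewrite memv_cap !mem_leigenspace LmulE RmulE.
by apply: (iffP andP) => [[/eqP ? /eqP ?]|[-> ->]].
Qed.

Lemma axis_assoc v : mul a (mul v a) = mul (mul a v) a.
Proof.
case: ha => _ _ _ /lfunP /(_ v).
by rewrite !comp_lfunE LmulE !RmulE LmulE.
Qed.

(* The components of v under R_a are polynomials in R_a applied to v, so they
   stay in any eigenspace of L_a. *)
Lemma Rmul_decomp_eig mu v :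
    mu != 1 -> mul a v = mu *: v ->
  exists2 q, q \in Aeig mul a mu 0 &
    exists2 r, r \in Aeig mul a mu del & v = q + r.
Proof.
case: ha => aa _ hR _ mu1 av.
have [p [q [r [ev /vlineP[c ep] q0 rd]]]] := axis_decomp hR v.
rewrite !RmulE in q0 rd.
set U := passmx.leigenspace (Lmul mul a) mu.
have stab u : u \in U -> mul u a \in U.
  rewrite !mem_leigenspace !LmulE axis_assoc => /eqP ->.
  by rewrite linearZl_LR.
have vU : v \in U by rewrite mem_leigenspace LmulE av.
have pa : mul p a = p by rewrite ep linearZl_LR aa.
have va : mul v a = p + del *: r.
  by rewrite ev !linearDl q0 rd addr0 pa.
have vaa : mul (mul v a) a = p + del *: (del *: r).
  by rewrite va linearDl linearZl_LR rd pa.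
have rU : r \in U.
  (* [R_a^2 - R_a] kills [p] and [q], and it multiplies [r] by [del * (del - 1)], which is
     nonzero. *)
  have -> : r = (del * (del - 1))^-1 *: (mul (mul v a) a - mul v a).
    rewrite vaa va opprD addrACA subrr add0r scalerA -scalerBl scalerA.
    have -> : del * del - del = del * (del - 1) by ring.
    by rewrite mulVf ?scale1r // mulf_neq0 // subr_eq0.
  by rewrite rpredZ // rpredB // !stab.
have pU : p \in U.
  have -> : p = mul v a - del *: r by rewrite va addrK.
  by rewrite rpredB ?rpredZ ?stab.
(* [p] is a multiple of [a], so [L_a] fixes it; lying in the [mu]-eigenspace with [mu != 1], it
   vanishes. *)
have p0 : p = 0.
  move: pU; rewrite mem_leigenspace LmulE ep linearZr_LR /= aa -subr_eq0.
  rewrite -{1}[_ *: a]scale1r -scalerBl scaler_eq0 subr_eq0 eq_sym (negPf mu1).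
  by move/eqP.
exists q; last exists r.
- have qU : q \in U by rewrite -[q](addrK r) -[q + r]add0r -p0 addrA -ev rpredB.
  apply/mem_Aeig; split; last by rewrite q0 scale0r.
  by apply/eqP; rewrite -LmulE -mem_leigenspace.
- by apply/mem_Aeig; split=> //; apply/eqP; rewrite -LmulE -mem_leigenspace.
- by rewrite ev p0 add0r.
Qed.

End PrimitiveAxis.

(** * Generation by [a] and [b] against a two-dimensional subalgebra *)

Section Generation.

Variables (F : fieldType) (A : vectType F) (mul : {bilinear A -> A -> A}).
Variables (a b : A).
Hypotheses (hgen : generated_by mul a b) (hdim : \dim {:A} = 3%N).

Lemma not_spanned_by_eigenvector c mu nu w :
    mul a a = a -> mul b b = b -> w \in Aeig mul a mu nu -> b <> c *: a + w.
Proof.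
move=> aa bb /mem_Aeig[aw wa] eb.
set U := (<[a]> + <[w]>)%VS.
have aU : a \in U by apply: subvP (addvSl _ _) _ (memv_line a).
have wU : w \in U by apply: subvP (addvSr _ _) _ (memv_line w).
have bU : b \in U by rewrite eb rpredD ?rpredZ.
have wwU : mul w w \in U.
  have -> : mul w w
      = mul b b - (c *: (c *: a) + c *: (nu *: w) + c *: (mu *: w)).
    rewrite eb linearDr !linearDl /=.
    rewrite !(linearZr_LR, linearZl_LR) /= aa aw wa addrA [RHS]addrAC.
    by rewrite subrr add0r.
  by rewrite bb !(rpredB, rpredD, rpredZ).
have full : U = fullv.
  apply: hgen => // u v /memv_addP[_ /vlineP[c1 ->] [_ /vlineP[c2 ->] ->]].
  move=> /memv_addP[_ /vlineP[d1 ->] [_ /vlineP[d2 ->] ->]].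
  rewrite linearDr !linearDl !(linearZr_LR, linearZl_LR) /= aa aw wa.
  by rewrite !(rpredD, rpredZ).
have := hdim; rewrite -full => e3.
have := dimv_add_leqif <[a]>%VS <[w]>%VS.
rewrite -/U e3 => -[+ _]; rewrite !dim_vline.
by case: (a != 0); case: (w != 0).
Qed.

End Generation.

(** * Coordinates with respect to three vectors *)

(* Locked, so that rewriting with lincombD and lincombZ does not unfold it. *)
HB.lock Definition lincomb (F : fieldType) (A : lmodType F) (u v w : A)
  (c1 c2 c3 : F) : A := c1 *: u + c2 *: v + c3 *: w.

Section LinearCombinations.

Variables (F : fieldType) (A : lmodType F) (u v w : A).

Local Notation lincomb := (lincomb u v w).

Lemma lincombD c1 c2 c3 d1 d2 d3 :
  lincomb c1 c2 c3 + lincomb d1 d2 d3 = lincomb (c1 + d1) (c2 + d2) (c3 + d3).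
Proof. by rewrite lincomb.unlock !scalerDl addrACA (addrACA (c1 *: u)). Qed.

Lemma lincombZ k c1 c2 c3 :
  k *: lincomb c1 c2 c3 = lincomb (k * c1) (k * c2) (k * c3).
Proof. by rewrite lincomb.unlock !scalerDr !scalerA. Qed.

Hypothesis uvw_free :
  forall c1 c2 c3, lincomb c1 c2 c3 = 0 -> [/\ c1 = 0, c2 = 0 & c3 = 0].

Lemma lincomb_inj c1 c2 c3 d1 d2 d3 :
  lincomb c1 c2 c3 = lincomb d1 d2 d3 -> [/\ c1 = d1, c2 = d2 & c3 = d3].
Proof.
move=> e; have /uvw_free[] : lincomb (c1 - d1) (c2 - d2) (c3 - d3) = 0.
  have -> : lincomb (c1 - d1) (c2 - d2) (c3 - d3)
      = lincomb c1 c2 c3 + -1 *: lincomb d1 d2 d3.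
    by rewrite lincombZ lincombD !mulN1r.
  by rewrite e scaleN1r subrr.
by move=> /subr0_eq -> /subr0_eq -> /subr0_eq ->.
Qed.

Lemma lincomb1 : u = lincomb 1 0 0.
Proof. by rewrite lincomb.unlock scale1r !scale0r !addr0. Qed.

Lemma lincomb2 : v = lincomb 0 1 0.
Proof. by rewrite lincomb.unlock scale1r !scale0r addr0 add0r. Qed.

Lemma lincomb3 : w = lincomb 0 0 1.
Proof. by rewrite lincomb.unlock scale1r !scale0r !add0r. Qed.

End LinearCombinations.

Lemma mul_eq0_neq1 (F : fieldType) (k c : F) : k != 1 -> c = k * c -> c = 0.
Proof.
move=> k1 e; apply/eqP; have /eqP : (k - 1) * c = 0.
  by rewrite mulrBl mul1r -e subrr.
by rewrite mulf_eq0 subr_eq0 (negPf k1).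
Qed.

(** This is [f (f v) = f v] read on a coordinate that [f] scales by [k]. *)
Lemma sqr_mul_eq0 (F : fieldType) (k c : F) :
  k != 0 -> k != 1 -> k * (k * c) = k * c -> c = 0.
Proof.
move=> k0 k1 /(mulfI k0) e; exact: (mul_eq0_neq1 k1 (esym e)).
Qed.

Lemma mul_eq0_neq0 (F : fieldType) (k c : F) : k != 0 -> k * c = 0 -> c = 0.
Proof. by move=> k0 /eqP; rewrite mulf_eq0 (negPf k0) => /eqP. Qed.

(** * Excluding a basis [a], [x], [w] of joint eigenvectors, scaled so that [b = al a + x + w] *)

Section HomogeneousBasis.

Variables (F : fieldType) (A : vectType F) (mul : {bilinear A -> A -> A}).
Variables (a b : A) (lam del lam' del' : F).
Hypotheses (hlam0 : lam != 0) (hlam1 : lam != 1).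
Hypotheses (hdel0 : del != 0) (hdel1 : del != 1).
Hypotheses (ha : primitive_axis mul a lam del).
Hypotheses (hb : primitive_axis mul b lam' del').
Variables (x w : A) (al mu nu : F).
Local Notation lc := (lincomb a x w).
Hypothesis lc_free :
  forall c1 c2 c3, lc c1 c2 c3 = 0 -> [/\ c1 = 0, c2 = 0 & c3 = 0].
Hypothesis lc_span : forall v, exists c1 c2 c3, v = lc c1 c2 c3.
Hypothesis eb : b = lc al 1 1.
Hypothesis xA : x \in Aeig mul a lam 0.
Hypothesis wA : w \in Aeig mul a mu nu.

Let aa : mul a a = lc 1 0 0. Proof. by case: ha => ->; rewrite -lincomb1. Qed.
Let ax : mul a x = lc 0 lam 0.
Proof.
by case/mem_Aeig: xA => -> _; rewrite {1}(lincomb2 a x w) lincombZ !mulr0 mulr1.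
Qed.
Let xa : mul x a = lc 0 0 0.
Proof.
by case/mem_Aeig: xA => _ ->; rewrite {1}(lincomb2 a x w) lincombZ !mul0r.
Qed.
Let aw : mul a w = lc 0 0 mu.
Proof.
by case/mem_Aeig: wA => -> _; rewrite {1}(lincomb3 a x w) lincombZ !mulr0 mulr1.
Qed.
Let wa : mul w a = lc 0 0 nu.
Proof.
by case/mem_Aeig: wA => _ ->; rewrite {1}(lincomb3 a x w) lincombZ !mulr0 mulr1.
Qed.
Let bb : mul b b = b. Proof. by case: hb. Qed.

Lemma mul_lincombl c1 c2 c3 v :
  mul (lc c1 c2 c3) v = c1 *: mul a v + c2 *: mul x v + c3 *: mul w v.
Proof. by rewrite lincomb.unlock !linearDl !linearZl_LR. Qed.

Lemma mul_lincombr c1 c2 c3 v :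
  mul v (lc c1 c2 c3) = c1 *: mul v a + c2 *: mul v x + c3 *: mul v w.
Proof. by rewrite lincomb.unlock !linearDr !linearZr_LR. Qed.

Let aL c1 c2 c3 : mul a (lc c1 c2 c3) = lc c1 (lam * c2) (mu * c3).
Proof.
rewrite mul_lincombr aa ax aw !lincombZ !lincombD.
by congr lincomb; ring.
Qed.

Let aR c1 c2 c3 : mul (lc c1 c2 c3) a = lc c1 0 (nu * c3).
Proof.
rewrite mul_lincombl aa xa wa !lincombZ !lincombD.
by congr lincomb; ring.
Qed.

(** Compare coordinates in [b b = b]: the [x] and [w] coordinates come only from products with [a].
    Serves both cases where [w] is odd for [R_a]. *)
Lemma two_odd_generators t s :
    mul x w = 0 -> mul w x = 0 -> mul x x = lc t 0 0 -> mul w w = lc s 0 0 ->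
  [/\ al * al + t + s = al, al * lam = 1 & al * (mu + nu) = 1].
Proof.
move=> xw wx xx ww; have := bb.
rewrite eb mul_lincombl !mul_lincombr xw wx xx ww aa ax xa aw wa.
rewrite !scaler0 !(lincombZ, lincombD, addr0).
move=> /(lincomb_inj lc_free)[e1 e2 e3].
by split; [rewrite -[RHS]e1|rewrite -[RHS]e2|rewrite -[RHS]e3]; ring.
Qed.

Let bL v : mul b v = al *: mul a v + mul x v + mul w v.
Proof. by rewrite eb mul_lincombl !scale1r. Qed.

Let bR v : mul v b = al *: mul v a + mul v x + mul v w.
Proof. by rewrite eb mul_lincombr !scale1r. Qed.

Let hL : one_sided_axis mul a (Lmul mul a) lam. Proof. by case: ha. Qed.
Let hR : one_sided_axis mul a (Rmul mul a) del. Proof. by case: ha. Qed.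
Let La : Lmul mul a a = a. Proof. by rewrite LmulE aa -lincomb1. Qed.
Let Ra : Rmul mul a a = a. Proof. by rewrite RmulE aa -lincomb1. Qed.
Let Lx : Lmul mul a x = lam *: x.
Proof. by rewrite LmulE; case/mem_Aeig: xA. Qed.
Let Rx : Rmul mul a x = 0.
Proof. by rewrite RmulE; case/mem_Aeig: xA => _ ->; rewrite scale0r. Qed.
Let Lw : Lmul mul a w = mu *: w.
Proof. by rewrite LmulE; case/mem_Aeig: wA. Qed.
Let Rw : Rmul mul a w = nu *: w.
Proof. by rewrite RmulE; case/mem_Aeig: wA. Qed.

(** [x] is odd for [L_a], so an even vector has no [x] coordinate; the [w] coordinate is excluded
    only when [w] is odd too. *)
Let Leven v c1 c2 c3 : Lmul mul a (Lmul mul a v) = Lmul mul a v ->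
  v = lc c1 c2 c3 -> c2 = 0 /\ (mu = lam -> c3 = 0).
Proof.
rewrite !LmulE => + ev; rewrite ev !aL => /(lincomb_inj lc_free)[_ e2 e3].
split; first exact: sqr_mul_eq0 e2.
by move=> em; move: e3; rewrite em; exact: sqr_mul_eq0.
Qed.

Let Reven v c1 c2 c3 : Rmul mul a (Rmul mul a v) = Rmul mul a v ->
  v = lc c1 c2 c3 -> nu = del -> c3 = 0.
Proof.
rewrite !RmulE => + ev; rewrite ev !aR => /(lincomb_inj lc_free)[_ _ e3] en.
by move: e3; rewrite en; exact: sqr_mul_eq0.
Qed.

Let Lodd v c1 c2 c3 : Lmul mul a v = lam *: v ->
  v = lc c1 c2 c3 -> c1 = 0 /\ (mu = 0 -> c3 = 0).
Proof.
rewrite !LmulE => + ev; rewrite ev aL lincombZ.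
move=> /(lincomb_inj lc_free)[e1 _ e3].
split; first exact: mul_eq0_neq1 e1.
by move=> em; move: e3; rewrite em mul0r => /esym; exact: mul_eq0_neq0.
Qed.

(** [R_a] fixes [a] and kills [x], so neither contributes to an eigenvector for [del], which differs
    from 0 and 1. *)
Let Rodd v c1 c2 c3 : Rmul mul a v = del *: v -> v = lc c1 c2 c3 ->
  c1 = 0 /\ c2 = 0.
Proof.
rewrite !RmulE => + ev; rewrite ev aR lincombZ.
move=> /(lincomb_inj lc_free)[e1 e2 _].
split; first exact: mul_eq0_neq1 e1.
exact: mul_eq0_neq0 (esym e2).
Qed.

Let lc0 : lc 0 0 0 = 0. Proof. by rewrite lincomb.unlock !scale0r !addr0. Qed.

Lemma not_eig_lam_del : mu = lam -> nu = del -> False.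
Proof.
move=> em en.
have Lw' : Lmul mul a w = lam *: w by rewrite Lw em.
have Rw' : Rmul mul a w = del *: w by rewrite Rw en.
(* Oddness for [R_a] leaves only a multiple of [w]; evenness for [L_a] removes it, since [w] is odd
   there. *)
have xw : mul x w = 0.
  have [c1 [c2 [c3 e]]] := lc_span (mul x w); rewrite e.
  have [-> ->] := Rodd (axis_mul01 hR Rx Rw') e.
  by have [_ ->] := Leven (axis_mul11 La hL Lx Lw') e.
have wx : mul w x = 0.
  have [c1 [c2 [c3 e]]] := lc_span (mul w x); rewrite e.
  have [-> ->] := Rodd (axis_mul10 hR Rw' Rx) e.
  by have [_ ->] := Leven (axis_mul11 La hL Lw' Lx) e.
have [t [c2 [c3 xx]]] := lc_span (mul x x).
have [c20 c30] := Leven (axis_mul11 La hL Lx Lx) xx.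
rewrite c20 c30 // in xx.
have [s [d2 [d3 ww]]] := lc_span (mul w w).
have [d20 d30] := Leven (axis_mul11 La hL Lw' Lw') ww.
rewrite d20 d30 // in ww.
have [_ e2] := two_odd_generators xw wx xx ww.
(* Subtracting [al * lam = 1] from [al * (lam + del) = 1] leaves [al * del = 0], so [al = 0],
   against [al * lam = 1]. *)
rewrite em en mulrDr e2 -[RHS]addr0 => /addrI/eqP.
rewrite mulf_eq0 (negPf hdel0) orbF => /eqP al0.
by move/eqP: e2; rewrite al0 mul0r eq_sym oner_eq0.
Qed.

Lemma not_eig_0_del : mu = 0 -> nu = del -> False.
Proof.
move=> em en.
have Lw' : Lmul mul a w = 0 by rewrite Lw em scale0r.
have Rw' : Rmul mul a w = del *: w by rewrite Rw en.
(* Again a multiple of [w] by [R_a], but now the product is odd for [L_a] while [w] is even. *)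
have xw : mul x w = 0.
  have [c1 [c2 [c3 e]]] := lc_span (mul x w); rewrite e.
  have [-> ->] := Rodd (axis_mul01 hR Rx Rw') e.
  by have [_ ->] := Lodd (axis_mul10 hL Lx Lw') e.
have wx : mul w x = 0.
  have [c1 [c2 [c3 e]]] := lc_span (mul w x); rewrite e.
  have [-> ->] := Rodd (axis_mul10 hR Rw' Rx) e.
  by have [_ ->] := Lodd (axis_mul01 hL Lw' Lx) e.
have [t [c2 [c3 xx]]] := lc_span (mul x x).
have [c20 _] := Leven (axis_mul11 La hL Lx Lx) xx.
have c30 := Reven (axis_mul00 Ra hR Rx Rx) xx en; rewrite c20 c30 in xx.
have [s [d2 [d3 ww]]] := lc_span (mul w w).
have [d20 _] := Leven (axis_mul00 La hL Lw' Lw') ww.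
have d30 := Reven (axis_mul11 Ra hR Rw' Rw') ww en; rewrite d20 d30 in ww.
have [e1 e2] := two_odd_generators xw wx xx ww.
rewrite em en add0r => e3.
have ba : mul b a = lc al 0 del.
  rewrite bL aa xa wa !lincombZ !lincombD en; by congr lincomb; ring.
have ab : mul a b = lc al lam 0.
  rewrite bR aa ax aw !lincombZ !lincombD em; by congr lincomb; ring.
have bx : mul b x = lc t 1 0.
  rewrite bL ax xx wx addr0 !lincombZ !lincombD e2; by congr lincomb; ring.
have xb : mul x b = lc t 0 0.
  rewrite bR xa xx xw addr0 !lincombZ !lincombD; by congr lincomb; ring.
have bw : mul b w = lc s 0 0.
  rewrite bL aw ww xw addr0 !lincombZ !lincombD em; by congr lincomb; ring.
have wb : mul w b = lc s 0 1.
  rewrite bR wa ww wx addr0 !lincombZ !lincombD en e3; by congr lincomb; ring.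
(* In [b (x b) = (b x) b] the left side [t *: mul b a] has no [x] coordinate, while the right side
   has [t * lam]. The same comparison at [w] kills [s]. *)
have t0 : t = 0.
  have := axis_assoc hb x; rewrite xb bx mul_lincombl mul_lincombr.
  rewrite ab ba bx bw xb wb !lincombZ !lincombD.
  move=> /(lincomb_inj lc_free)[_ h _]; apply: (mul_eq0_neq0 hlam0).
  rewrite mulrC -[t * lam](addr0 _); move: h; rewrite !(mul0r, mulr0, addr0).
  by move=> <-.
have s0 : s = 0.
  have := axis_assoc hb w; rewrite wb bw mul_lincombl mul_lincombr.
  rewrite ab ba bx bw xb wb !lincombZ !lincombD.
  move=> /(lincomb_inj lc_free)[_ h _]; apply: (mul_eq0_neq0 hlam0).
  rewrite mulrC -[s * lam](addr0 _); move: h; rewrite !(mul0r, mulr0, addr0).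
  by move=> <-.
have al0 : al != 0.
  by apply: contra_eq_neq e2 => ->; rewrite mul0r eq_sym oner_eq0.
have al1 : al = 1.
  apply: (mulfI al0); rewrite mulr1 -[RHS]e1 t0 s0; ring.
by move/eqP: e2; rewrite al1 mul1r (negPf hlam1).
Qed.

Lemma not_eig_0_0 : mu = 0 -> nu = 0 -> False.
Proof.
move=> em en.
have Lw' : Lmul mul a w = 0 by rewrite Lw em scale0r.
have [p1 [p2 [p3 xx]]] := lc_span (mul x x).
have [p20 _] := Leven (axis_mul11 La hL Lx Lx) xx; rewrite p20 in xx.
have [q1 [q [q3 xw]]] := lc_span (mul x w).
have [q10 q30] := Lodd (axis_mul10 hL Lx Lw') xw; rewrite q10 q30 // in xw.
have [r1 [r [r3 wx]]] := lc_span (mul w x).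
have [r10 r30] := Lodd (axis_mul01 hL Lw' Lx) wx; rewrite r10 r30 // in wx.
have [s1 [s2 [s3 ww]]] := lc_span (mul w w).
have [s20 _] := Leven (axis_mul00 La hL Lw' Lw') ww; rewrite s20 in ww.
have ba : mul b a = lc al 0 0.
  rewrite bL aa xa wa !lincombZ !lincombD en; by congr lincomb; ring.
have ab : mul a b = lc al lam 0.
  rewrite bR aa ax aw !lincombZ !lincombD em; by congr lincomb; ring.
have bx : mul b x = lc p1 (al * lam + r) p3.
  rewrite bL ax xx wx !lincombZ !lincombD; by congr lincomb; ring.
have hLb : one_sided_axis mul b (Lmul mul b) lam' by case: hb.
have not_al1 : al <> 1.
  (* With [al = 1], [L_b] fixes [a], so [a] would be a multiple of [b]; but [b] has [x] coordinate
     1. *)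
  move=> al1.
  have /(axis_fixed hLb)/vlineP[c] : Lmul mul b a = a.
    by rewrite LmulE ba al1 -lincomb1.
  rewrite eb lincombZ {1}(lincomb1 a x w).
  move=> /(lincomb_inj lc_free)[/eqP + + _]; rewrite mulr1 => + c0.
  by rewrite -c0 mul0r oner_eq0.
have al0 : al = 0.
  have Lba : Lmul mul b a = al *: a.
    by rewrite LmulE ba {2}(lincomb1 a x w) lincombZ !mulr0 mulr1.
  have a0 : a != 0.
    apply/eqP => a0; have := lincomb1 a x w; rewrite {1}a0.
    by rewrite -lc0 => /(lincomb_inj lc_free)[/esym/eqP]; rewrite oner_eq0.
  case: (axis_eigenvalue hLb a0 Lba) => [//|/not_al1 //|el].
  have Lbb : Lmul mul b b = b by rewrite LmulE.
  (* If [al = lam'], then [a] is odd for [L_b] while [a = a a] is even, so [al * al = al]; since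
     [al] is not 1, it is 0. *)
  have := axis_mul11 Lbb hLb; rewrite -el => /(_ _ _ Lba Lba).
  rewrite aa -lincomb1 Lba linearZ /= Lba (lincomb1 a x w) !lincombZ.
  move=> /(lincomb_inj lc_free)[h _ _]; rewrite !mulr1 in h.
  apply/eqP; apply/negPn/negP => al0; apply: not_al1.
  by apply: (mulfI al0); rewrite h mulr1.
have [p10 r0 p30] : [/\ p1 = 0, r = 0 & p3 = 0].
  (* With [al = 0] one has [b a = 0] and [a b = lam x], so [b (a b) = (b a) b] says
     [lam *: mul b x = 0]. *)
  have := axis_assoc hb a; rewrite ab ba mul_lincombl mul_lincombr.
  rewrite ba bx ab al0 !scale0r !add0r addr0 !lincombZ.
  rewrite -lc0 => /(lincomb_inj lc_free)[h1 h2 h3].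
  split; apply: (mul_eq0_neq0 hlam0).
  - by rewrite -[RHS]h1; ring.
  - by rewrite -[RHS]h2; ring.
  - by rewrite -[RHS]h3; ring.
rewrite p10 p30 in xx; rewrite r0 in wx.
have bx0 : mul b x = 0 by rewrite bx al0 mul0r p10 r0 p30 addr0.
have bw : mul b w = lc s1 q s3.
  by rewrite bL al0 scale0r add0r xw ww lincombD !(add0r, addr0).
(* Since [b = x + w] and [b x = 0], idempotence reads [b w = b]; compare [x] coordinates. *)
have q1' : q = 1.
  have := bb; rewrite {2}eb mul_lincombr ba bx0 bw al0 scaler0 eb al0 addr0.
  by rewrite scale0r add0r scale1r => /(lincomb_inj lc_free)[].
have xb : mul x b = x.
  rewrite bR al0 scale0r add0r xx xw q1' lincombD !(add0r, addr0).
  by rewrite -lincomb2.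
have hRb : one_sided_axis mul b (Rmul mul b) del' by case: hb.
have /(axis_fixed hRb)/vlineP[c] : Rmul mul b x = x by rewrite RmulE.
rewrite eb lincombZ {1}(lincomb2 a x w) => /(lincomb_inj lc_free)[_ /eqP + c0].
by rewrite -c0 oner_eq0.
Qed.

End HomogeneousBasis.

(** * Vanishing of the joint eigenspace for [lam] and 0 *)

Lemma Aeig_lam_0 (F : fieldType) (A : vectType F)
    (mul : {bilinear A -> A -> A}) (a b : A) (lam del lam' del' : F) :
    lam != 0 -> lam != 1 -> del != 0 -> del != 1 ->
    primitive_axis mul a lam del -> primitive_axis mul b lam' del' ->
    generated_by mul a b -> \dim {:A} = 3%N ->
  Aeig mul a lam 0 = 0%VS.
Proof.
move=> lam0 lam1 del0 del1 ha hb hgen hdim.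
apply/eqP; rewrite -subv0; apply/subvP => x xA; rewrite memv0.
apply/negPn/negP => x0.
have [aa hL _ _] := ha; have [bb _ _ _] := hb.
have [ax xa] := mem_Aeig _ _ _ _ _ xA.
have a0 : a != 0.
  apply: contraNneq x0 => a0; move/eqP: ax; rewrite a0 linear0l eq_sym.
  by rewrite scaler_eq0 (negPf lam0).
have xNa : x \notin <[a]>%VS.
  apply: contraNN x0 => /vlineP[c ex]; move: xa.
  by rewrite {1}ex linearZl_LR /= aa -ex scale0r => ->.
have not_spanned := not_spanned_by_eigenvector hgen hdim aa bb.
set U := (<[a]> + <[x]>)%VS.
(* A joint eigenvector outside [U] would complete [a], [x] to a basis, and each of the four types is
   contradictory. So [U] contains all joint eigenvectors, hence all of [A], although its dimension
   is at most 2. *)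
have outside mu nu w : w \in Aeig mul a mu nu -> w \notin U ->
    (mu, nu) \in [:: (0, 0); (lam, 0); (0, del); (lam, del)] -> False.
  move=> wA wU types.
  have full := span3_full hdim a0 xNa wU.
  have lc_free := free3_coords a0 xNa wU.
  have span v : exists c1 c2 c3, v = c1 *: a + c2 *: x + c3 *: w.
    have := memvf v; rewrite -full.
    case/memv_addP=> _ /memv_addP[_ /vlineP[c1 ->] [_ /vlineP[c2 ->] ->]].
    by case=> _ /vlineP[c3 ->] ->; exists c1, c2, c3.
  have [al [c2 [c3 eb]]] := span b.
  have c20 : c2 != 0.
    apply/eqP => c20; move: eb; rewrite c20 scale0r addr0.
    by apply: not_spanned; rewrite rpredZ //; exact: wA.
  have c30 : c3 != 0.
    apply/eqP => c30; move: eb; rewrite c30 scale0r addr0.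
    by apply: not_spanned; rewrite rpredZ //; exact: xA.
  have xA' : c2 *: x \in Aeig mul a lam 0 by rewrite rpredZ.
  have wA' : c3 *: w \in Aeig mul a mu nu by rewrite rpredZ.
  have eb' : b = lincomb a (c2 *: x) (c3 *: w) al 1 1.
    by rewrite lincomb.unlock !scale1r.
  have lc_free' d1 d2 d3 : lincomb a (c2 *: x) (c3 *: w) d1 d2 d3 = 0 ->
      [/\ d1 = 0, d2 = 0 & d3 = 0].
    rewrite lincomb.unlock !scalerA => /lc_free[-> /eqP + /eqP].
    by rewrite !mulf_eq0 (negPf c20) (negPf c30) !orbF => /eqP-> /eqP->.
  have span' v : exists d1 d2 d3, v = lincomb a (c2 *: x) (c3 *: w) d1 d2 d3.
    have [d1 [d2 [d3 ->]]] := span v; exists d1, (d2 / c2), (d3 / c3).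
    by rewrite lincomb.unlock !scalerA !divfK.
  move: types; rewrite !inE !xpair_eqE.
  case/or4P=> /andP[/eqP emu /eqP enu].
  - exact: (not_eig_0_0 lam0 lam1 ha hb lc_free' span' eb' xA' wA').
  (* Here the two summands lie in the same eigenspace, so [b] is a multiple of [a] plus one
     eigenvector. *)
  - rewrite emu enu in wA'; move: eb; rewrite -addrA.
    by apply: not_spanned; rewrite rpredD //; [exact: xA'|exact: wA'].
  - exact: (not_eig_0_del lam0 lam1 del0 del1 ha hb lc_free' span' eb' xA' wA').
  - exact: (not_eig_lam_del lam0 lam1 del0 del1 ha hb lc_free' span' eb'
              xA' wA').
have inU mu nu w : w \in Aeig mul a mu nu ->
    (mu, nu) \in [:: (0, 0); (lam, 0); (0, del); (lam, del)] -> w \in U.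
  by move=> wA types; apply/negPn/negP => wU; exact: outside wA wU types.
have fullU : (fullv <= U)%VS.
  apply/subvP => v _.
  have [p [q [r [-> pa q0 rl]]]] := axis_decomp hL v; rewrite !LmulE in q0 rl.
  have eig mu y : mu \in [:: 0; lam] -> mul a y = mu *: y -> y \in U.
    move=> emu ay.
    have mu1 : mu != 1.
      by move: emu; rewrite !inE => /orP[] /eqP -> //; rewrite eq_sym oner_eq0.
    have [s sA [t tA ->]] := Rmul_decomp_eig del0 del1 ha mu1 ay.
    move: emu; rewrite !inE => emu.
    by apply: rpredD; [apply: inU sA _|apply: inU tA _];
      rewrite !inE !xpair_eqE !eqxx !andbT; case/orP: emu => ->; rewrite ?orbT.
  rewrite !rpredD //; first exact: subvP (addvSl _ _) _ pa.
  - by apply: (eig 0); rewrite ?inE ?eqxx // q0 scale0r.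
  - by apply: (eig lam); rewrite ?inE ?eqxx ?orbT.
have := dimvS fullU; rewrite hdim => d3.
have [d2 _] := dimv_add_leqif <[a]>%VS <[x]>%VS.
by have := leq_trans d3 d2; rewrite !dim_vline a0 x0.
Qed.

(** * The opposite algebra, where left and right multiplications change places *)

Section Opposite.

Variables (F : fieldType) (A : vectType F) (mul : {bilinear A -> A -> A}).

Definition opp_mul (u v : A) : A := mul v u.

Lemma opp_mul_bilinear : bilinear_for *:%R *:%R opp_mul.
Proof.
by split=> [w c u v|w c u v]; rewrite /opp_mul (linearPr, linearPl).
Qed.

HB.instance Definition _ :=
  bilinear_isBilinear.Build F A A A *:%R *:%R opp_mul opp_mul_bilinear.

Lemma Lmul_opp c : Lmul opp_mul c = Rmul mul c.
Proof. by apply/lfunP => v; rewrite !lfunE. Qed.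

Lemma Rmul_opp c : Rmul opp_mul c = Lmul mul c.
Proof. by apply/lfunP => v; rewrite !lfunE. Qed.

Lemma Aeig_opp a mu nu : Aeig opp_mul a mu nu = Aeig mul a nu mu.
Proof. by rewrite /Aeig Lmul_opp Rmul_opp capvC. Qed.

Lemma prod_in_opp U V W : prod_in mul U V W -> prod_in opp_mul V U W.
Proof. by move=> h u v uV vU; exact: h. Qed.

Lemma one_sided_axis_opp a f mu :
  one_sided_axis mul a f mu -> one_sided_axis opp_mul a f mu.
Proof.
case=> h1 h2 h3 [h4 [h5 [? ? ? ?]]].
by do 3?split=> //; split; exact: prod_in_opp.
Qed.

Lemma primitive_axis_opp a lam del :
  primitive_axis mul a lam del -> primitive_axis opp_mul a del lam.
Proof.
case=> aa hL hR hLR; split=> //; rewrite ?Lmul_opp ?Rmul_opp //;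
  exact: one_sided_axis_opp.
Qed.

Lemma generated_by_opp a b : generated_by mul a b -> generated_by opp_mul a b.
Proof.
by move=> h U aU bU hU; apply: h => // u v uU vU; exact: hU.
Qed.

End Opposite.

(** * Symmetry in the two generators and the Jordan type of both axes *)

Lemma generated_byC (F : fieldType) (A : vectType F)
    (mul : {bilinear A -> A -> A}) (a b : A) :
  generated_by mul a b -> generated_by mul b a.
Proof. by move=> h U bU aU; exact: h. Qed.

Lemma primitive_axis_Jordan (F : fieldType) (A : vectType F)
    (mul : {bilinear A -> A -> A}) (a b : A) (lam del lam' del' : F) :
    lam != 0 -> lam != 1 -> del != 0 -> del != 1 ->
    primitive_axis mul a lam del -> primitive_axis mul b lam' del' ->
    generated_by mul a b -> \dim {:A} = 3%N ->
  Jordan_type mul a lam del.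
Proof.
move=> lam0 lam1 del0 del1 ha hb hgen hdim; split=> //.
  exact: Aeig_lam_0 ha hb hgen hdim.
(* In the opposite algebra [a] has type [(del, lam)], and this eigenspace becomes the one for [del]
   and 0. *)
rewrite -Aeig_opp.
exact: Aeig_lam_0 del0 del1 lam0 lam1 (primitive_axis_opp ha)
  (primitive_axis_opp hb) (generated_by_opp hgen) hdim.
Qed.

Theorem theoremB (F : fieldType) (A : vectType F)
  (mul : {bilinear A -> A -> A}) (a b : A) (lam del lam' del' : F)
  (hlam0 : lam != 0) (hlam1 : lam != 1) (hdel0 : del != 0) (hdel1 : del != 1)
  (hlam'0 : lam' != 0) (hlam'1 : lam' != 1)
  (hdel'0 : del' != 0) (hdel'1 : del' != 1)
  (ha : primitive_axis mul a lam del)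
  (hb : primitive_axis mul b lam' del')
  (hgen : generated_by mul a b)
  (hdim : \dim {:A} = 3%N) :
  Jordan_type mul a lam del /\ Jordan_type mul b lam' del'.
Proof.
split; first exact: primitive_axis_Jordan ha hb hgen hdim.
exact: primitive_axis_Jordan hb ha (generated_byC hgen) hdim.
Qed.
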